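(* Let $G$ be an interval graph. Then $\chi_{_{=}}(G)=\chi_{_{=}}^*(G)$.
   Context: All graphs are finite, loopless, and without multiple edges. A graph $G=(V,E)$ is an interval graph if there is a family $\{I_v \mid v\in V\}$ of intervals on the real line such that distinct vertices $u$ and $v$ are adjacent if and only if $I_u\cap I_v\neq\emptyset$. A proper $k$-coloring of $G$ is a function $c:V(G)\to\{0,1,\ldots,k-1\}$ mapping adjacent vertices to distinct numbers; its color classes are $V_i=c^{-1}(i)$, $0\leqslant i\leqslant k-1$. $G$ is equitably $k$-colorable if it has a proper $k$-coloring whose color classes satisfy $\big||V_i|-|V_j|\big|\leqslant 1$ for all $i,j\in\{0,\ldots,k-1\}$. The equitable chromatic number $\chi_{_{=}}(G)$ is the smallest integer $n$ such that $G$ is equitably $n$-colorable. The equitable chromatic threshold $\chi_{_{=}}^*(G)$ is the smallest integer $n$ such that $G$ is equitably $k$-colorable for all $k\geqslant n$. *)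

(* Defs.v *)
From mathcomp Require Import all_boot all_order all_algebra.
From mathcomp Require Import boolp classical_sets reals num_normedtype.

Set Implicit Arguments.
Unset Strict Implicit.
Unset Printing Implicit Defensive.

Import Order.TTheory GRing.Theory Num.Theory.

Record sgraph := SGraph {
  vertex :> finType;
  adj : rel vertex;
  adj_sym : symmetric adj;
  adj_irr : irreflexive adj
}.

(* The intervals may be open, closed, half-open, bounded or not; [is_interval]
   also admits the empty set, which yields an isolated vertex. *)
Definition interval_graph (R : realType) (G : sgraph) : Prop :=
  exists I : G -> set R,
    (forall v, is_interval (I v)) /\
    (forall u v : G, u != v -> (adj u v <-> (I u `&` I v !=set0)%classic)).

Definition proper_coloring (G : sgraph) (k : nat) (c : {ffun G -> 'I_k}) : bool :=
  [forall u : G, forall v : G, adj u v ==> (c u != c v)].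

Definition color_class (G : sgraph) (k : nat) (c : {ffun G -> 'I_k}) (i : 'I_k) :
  {set G} := [set v : G | c v == i]%SET.

(* The difference below is an integer one, not the truncated [subn]. *)
Definition equitably_colorable (G : sgraph) (k : nat) : bool :=
  [exists c : {ffun G -> 'I_k}, proper_coloring c &&
    [forall i : 'I_k, forall j : 'I_k,
      `|#|color_class c i| - #|color_class c j| |%N <= 1]].

Lemma equitably_colorable_ge_card (G : sgraph) (k : nat) :
  #|G| <= k -> equitably_colorable G k.
Proof.
move=> leGk; pose c := [ffun v : G => widen_ord leGk (enum_rank v)].
have c_inj : injective c.
  by move=> u v; rewrite !ffunE => /(congr1 val)/= /val_inj/enum_rank_inj.
have cle1 i : #|color_class c i| <= 1.
  apply/card_le1_eqP => u v; rewrite !inE => /eqP cu /eqP cv.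
  by apply: c_inj; rewrite cu cv.
apply/existsP; exists c; apply/andP; split.
  apply/forallP => u; apply/forallP => v; apply/implyP => uv.
  by apply: contraTneq uv => /c_inj ->; rewrite adj_irr.
apply/forallP => i; apply/forallP => j.
by move: (cle1 i) (cle1 j); case: #|_| => [|[|//]]; case: #|_| => [|[|//]].
Qed.

Lemma equitable_chromatic_number_subproof (G : sgraph) :
  exists n, equitably_colorable G n.
Proof. by exists #|G|; apply: equitably_colorable_ge_card. Qed.

Definition equitable_chromatic_number (G : sgraph) : nat :=
  ex_minn (equitable_chromatic_number_subproof G).

Lemma equitable_chromatic_threshold_subproof (G : sgraph) :
  exists n, `[< forall k, n <= k -> equitably_colorable G k >].
Proof.
by exists #|G|; apply/asboolP => k; apply: equitably_colorable_ge_card.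
Qed.

Definition equitable_chromatic_threshold (G : sgraph) : nat :=
  ex_minn (equitable_chromatic_threshold_subproof G).

(* Main.v *)
Require Import Defs.
From mathcomp Require Import all_boot all_order all_algebra.
From mathcomp Require Import boolp classical_sets reals num_normedtype.
From mathcomp Require Import zify.

Set Implicit Arguments.
Unset Strict Implicit.
Unset Printing Implicit Defensive.

(** The content of the theorem is that an equitably k-colorable interval graph
    is equitably (k+1)-colorable; every k above the equitable chromatic number
    is then attained, so the threshold cannot exceed it.

    Intervals enter only through the order of their right ends: listing the
    vertices along it, if u, v, w occur in this order and u is adjacent to w,
    then v is adjacent to w ([interval_right_end_order]).

    Given an equitable k-coloring of n = q (k+1) + r vertices with r <= k, view
    the classes as k streams of intervals running from left to right on k of
    k+1 parallel tracks, the last track being empty.  Whenever a stream is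
    between two of its intervals it may continue on the empty track; what it
    leaves behind becomes the new empty track, and lies entirely to the left of
    whatever is moved there later.  Let E be the set of intervals on the empty
    track and t the next prescribed size.  As its intervals end one by one, each
    stream reaches the moment when t - #|E| of them remain; the stream that
    reaches it first moves, completing with E a class of exactly t vertices.
    At that moment the other streams still have t - #|E| intervals to start, and
    the part left behind is at least as large as E, so the same step applies
    again to the next prescribed size t' <= t ([redistribute]).  It does not
    matter which stream moves at which step: the prescribed sizes are respected
    anyway.

    The prescribed sizes are r times q+1 followed by q, and the last contents of
    the empty track form the additional class, of size q.  A stream must contain
    at least as many vertices as are prescribed, so only the classes with more
    than q vertices are redistributed; by equitability the others have exactly q
    vertices and can be kept ([equitably_colorableS]). *)

(* The classical set library reuses many names of the finite set library. *)
Import mathcomp.boot.fintype mathcomp.boot.finset Order.TTheory.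

(** * Ordering the vertices by right ends *)

Definition right_end_order (G : sgraph) (pos : G -> nat) : Prop :=
  injective pos /\
  forall u v w, pos u < pos v -> pos v < pos w -> adj u w -> adj v w.

(** Intervals are compared by asking that every point of one be below some point
    of the other, which needs no endpoint to exist and puts empty intervals
    first.  If u, v, w are in this order, a common point x of the intervals of u
    and w lies below some y in that of v, itself below some z in that of w; then
    y lies between x and z, hence in the interval of w as well. *)
Lemma interval_right_end_order (R : realType) (G : sgraph) :
  interval_graph R G -> exists pos : G -> nat, right_end_order pos.
Proof.
move=> [I [itvI adjI]].
pose le v w := `[< forall x, I v x -> exists2 y, I w y & (x <= y)%R >].
have le_trans : transitive le.
  move=> v u w /asboolP uv /asboolP vw; apply/asboolP => x /uv[y /vw[z Iz yz] xy].
  by exists z => //; apply: Order.le_trans yz.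
have le_total : total le.
  move=> v w; case: (boolP (le v w)) => //= /asboolP /existsNP[x].
  move=> /not_implyP[Ix nx]; apply/asboolP => y Iy; exists x => //.
  by rewrite leNgt; apply/negP => xy; apply: nx; exists y => //; exact: ltW.
pose s := sort le (enum G).
have mem_s v : v \in s by rewrite mem_sort mem_enum.
have lt_le u v : index u s < index v s -> le u v.
  by apply: sorted_ltn_index => //; exact: sort_sorted.
(* Positions in a sorted enumeration, unlike right ends, have no ties. *)
exists (index^~ s); split=> [u v /= eq_uv|u v w uv vw].
  by rewrite -(nth_index u (mem_s u)) eq_uv nth_index.
have neq_uw : u != w by apply: contraTneq (ltn_trans uv vw) => ->; rewrite ltnn.
have neq_vw : v != w by apply: contraTneq vw => ->; rewrite ltnn.
move=> /(adjI _ _ neq_uw)[x [Iux Iwx]]; apply/(adjI _ _ neq_vw).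
have /asboolP/(_ x Iux)[y Ivy xy] := lt_le _ _ uv.
have /asboolP/(_ y Ivy)[z Iwz yz] := lt_le _ _ vw.
exists y; split=> //; apply: (itvI w x z) => //.
by rewrite xy yz.
Qed.

(** * The last elements of a set *)

(** Counting the larger elements is an explicit formula for the c largest ones,
    monotone in c, that involves no sorting. *)
Definition last_elts (T : finType) (pos : T -> nat) (c : nat) (A : {set T}) :
  {set T} :=
  [set x in A | #|[set y in A | pos x < pos y]| < c]%SET.

Lemma last_elts_sub (T : finType) (pos : T -> nat) (c : nat) (A : {set T}) :
  last_elts pos c A \subset A.
Proof. by apply/subsetP => x; rewrite inE => /andP[]. Qed.

Lemma last_elts_mono (T : finType) (pos : T -> nat) (c d : nat) (A : {set T}) :
  c <= d -> last_elts pos c A \subset last_elts pos d A.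
Proof.
move=> cd; apply/subsetP => x; rewrite !inE => /andP[-> /=].
by move=> h; exact: leq_trans cd.
Qed.

Lemma last_elts_after (T : finType) (pos : T -> nat) (c : nat) (A : {set T}) x y :
  x \in A :\: last_elts pos c A -> y \in last_elts pos c A -> pos x < pos y.
Proof.
rewrite !inE => /andP[+ Ax] /andP[Ay ltc]; rewrite Ax /= -leqNgt => lec.
rewrite ltnNge; apply/negP => yx.
have := leq_trans ltc lec; rewrite ltnNge => /negP; apply.
apply: subset_leq_card; apply/subsetP => z; rewrite !inE => /andP[-> /=].
exact: leq_ltn_trans.
Qed.

(** Removing the smallest element of the set does not change the number of
    elements above any of the others. *)
Lemma card_last_elts (T : finType) (pos : T -> nat) (c : nat) (A : {set T}) :
  injective pos -> c <= #|A| -> #|last_elts pos c A| = c.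
Proof.
move=> inj_pos lecA.
suff -> : #|last_elts pos c A| = minn c #|A| by exact/minn_idPl.
move: {lecA}_.+1 {-2}A (ltnSn #|A|) => m; elim: m => // m IHm {}A leAm.
have [->|[x0 Ax0]] := set_0Vmem A.
  by apply/eqP; rewrite cards0 minn0 cards_eq0 -subset0 last_elts_sub.
have [x Ax minx] := arg_minnP pos Ax0.
have {}Ax : x \in A := Ax.
have cardA := cardsD1 x A; rewrite Ax in cardA.
have lt_x y : y \in A :\ x -> pos x < pos y.
  rewrite !inE => /andP[yx Ay]; rewrite ltn_neqAle minx // andbT.
  by apply: contraNneq yx => /inj_pos ->.
have above_x : [set y in A | pos x < pos y]%SET = A :\ x.
  apply/setP => y; apply/idP/idP => [|Ay]; last first.
    by rewrite inE lt_x // andbT; case/setD1P: Ay.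
  rewrite !inE => /andP[-> xy]; rewrite andbT.
  by apply: contraTneq xy => ->; rewrite ltnn.
have last_x : last_elts pos c A :\ x = last_elts pos c (A :\ x).
  apply/setP => y; rewrite !inE; have [->|yx] //= := eqVneq y x.
  case: (boolP (y \in A)) => //= Ay; congr (#|pred_of_set _| < c).
  apply/setP => z; rewrite !inE; have [->|//] := eqVneq z x.
  by rewrite ltnNge minx // andbF.
rewrite (cardsD1 x) last_x IHm; last by rewrite cardA in leAm.
(* The minimum x is counted exactly when c exceeds the size of A :\ x. *)
rewrite inE Ax above_x cardA /=; lia.
Qed.

(** * Redistributing color classes into prescribed sizes *)

Lemma card_preimset_sum (T I : finType) (c : T -> I) (K : {set I}) :
  #|c @^-1: K| = \sum_(j in K) #|c @^-1: [set j]|.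
Proof.
rewrite -sum1_card (partition_big c (mem K)) => [|v]; last by rewrite inE.
apply: eq_bigr => j Kj; rewrite -sum1_card; apply: eq_bigl => v.
by rewrite !inE; case: eqP => [->|]; rewrite ?andbF ?andbT.
Qed.

Lemma sorted_two_levels (q r s : nat) :
  sorted geq (rcons (nseq r q.+1 ++ nseq s q) q).
Proof.
have geq_trans : transitive geq by move=> a b d /=; lia.
rewrite -cats1 -catA cats1 -[rcons _ _]/(rcons (nseq s q) q).
elim: r => [|r IHr] /=.
  elim: s => //= s IHs; rewrite path_sortedE // IHs all_rcons all_nseq /=.
  by rewrite leqnn orbT.
rewrite path_sortedE // IHr all_cat all_rcons !all_nseq /=.
by rewrite leqnn leqnSn !orbT.
Qed.

Definition proper_on (G : sgraph) (K : eqType) (U : {set G}) (g : G -> K) : Prop :=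
  {in U &, forall u v, adj u v -> g u != g v}.

(** The greedy procedure described at the top, by induction on the list [ts] of
    sizes still prescribed: [J] is the set of colors of the streams that have
    not moved, [E] is the content of the empty track, and the adjacency hypothesis
    linking [J] to [E] says that the intervals which may have to join [E] are
    compatible with it.  The class closed by stream [i] receives the color
    [Some i] and the final content of the empty track receives [None], so that
    the new coloring uses one color more than there are streams. *)
Lemma redistribute (G : sgraph) (pos : G -> nat) (I : finType) (c : G -> I)
    (ts : seq nat) (w : nat) (J : {set I}) (E : {set G}) :
  right_end_order pos ->
  proper_on [set: G] c ->
  size ts = #|J| ->
  sorted geq (rcons ts w) ->
  {in J, forall j, head w ts <= #|c @^-1: [set j]|} ->
  [disjoint E & c @^-1: J] ->
  {in E &, forall u v, ~~ adj u v} ->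
  {in J & E, forall j u,
    {in last_elts pos (head w ts - #|E|) (c @^-1: [set j]), forall v, ~~ adj u v}} ->
  #|E| + #|c @^-1: J| = sumn ts + w ->
  exists g : G -> option I,
    [/\ proper_on (E :|: c @^-1: J) g,
        {in E :|: c @^-1: J, forall v, oapp (mem J) true (g v)},
        {in J, forall j, #|[set v in E :|: c @^-1: J | g v == Some j]%SET| \in ts}
      & #|[set v in E :|: c @^-1: J | g v == None]%SET| = w].
Proof.
move=> [inj_pos chord] proper_c.
elim: ts J E => [|t ts IHts] J E /=.
  move=> /esym/eqP; rewrite cards_eq0 => /eqP -> _ _ _ indepE _.
  rewrite preimset0 cards0 setU0 addn0 add0n => cardE.
  exists (fun=> None); split=> //= [u v uE vE|j|]; last 2 first.
  - by rewrite inE.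
  - by rewrite -cardE; apply: eq_card => v; rewrite inE eqxx andbT.
  by move=> uv; have := indepE _ _ uE vE; rewrite uv.
move=> size_ts sorted_ts leJ disjE indepE indepEJ cardEJ.
have [t_ge sorted_ts'] : all (geq t) (rcons ts w) /\ sorted geq (rcons ts w).
  move: sorted_ts; rewrite path_sortedE; first by move=> /andP.
  by move=> a b d /=; lia.
have le_wt : w <= t by move: t_ge; rewrite all_rcons => /andP[].
have le_tst : all (geq t) ts by move: t_ge; rewrite all_rcons => /andP[].
(* The streams cover the prescribed sizes, which leaves at most w for E. *)
have le_Et : #|E| <= t.
  have le1 : #|J| * t <= #|c @^-1: J|.
    by rewrite card_preimset_sum -sum_nat_const; apply: leq_sum.
  have le2 : sumn ts <= size ts * t.
    elim: (ts) le_tst => //= a s IHs /andP[ta /IHs]; rewrite mulSn; lia.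
  by rewrite -size_ts mulSn in le1; lia.
pose A j := c @^-1: [set j].
pose S j := last_elts pos (t - #|E|) (A j).
have cardS j : j \in J -> #|S j| = t - #|E|.
  by move=> Jj; rewrite card_last_elts //; have := leJ _ Jj; rewrite -/(A j); lia.
have subSA j : S j \subset A j by exact: last_elts_sub.
(* The time at which stream j has t - #|E| intervals left; the successor
   makes it 0 when they are all of its intervals. *)
pose endp j := \max_(v in A j :\: S j) (pos v).+1.
have [j0 Jj0] : exists j, j \in J by apply/card_gt0P; rewrite -size_ts.
have [i Ji min_i] := arg_minnP endp Jj0.
have {}Ji : i \in J := Ji.
pose X := E :|: S i; pose E' := A i :\: S i; pose J' := J :\ i.
have cA v j : (v \in A j) = (c v == j) by rewrite !inE.
have cE v : v \in E -> c v \notin J.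
  by move=> Ev; apply/negP => Jv; move/pred0P/(_ v): disjE; rewrite /= Ev inE Jv.
have cardX : #|X| = t.
  rewrite cardsU cardS //; suff -> : E :&: S i = set0 by rewrite cards0; lia.
  apply/setP => v; rewrite !inE; apply/negP => /andP[/cE /negP Jv].
  by move=> /andP[/eqP cv _]; rewrite cv in Jv.
have cardE' : #|E'| = #|A i| - (t - #|E|).
  by rewrite cardsD (setIidPr (subSA i)) cardS.
have cardAi : t <= #|A i| by exact: leJ.
have E'P v : v \in E' -> c v = i by rewrite in_setD cA => /andP[_ /eqP].
have cJ v (K : {set I}) : (v \in c @^-1: K) = (c v \in K) by rewrite inE.
have cS v j : v \in S j -> c v = j by move=> /(subsetP (subSA j)); rewrite cA => /eqP.
have U_X : E :|: c @^-1: J = X :|: (E' :|: c @^-1: J').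
  apply/setP => v; rewrite /X /E' /J' !in_setU in_setD cA !cJ in_setD1.
  have [cv|cv] := eqVneq (c v) i.
    by rewrite cv Ji; case: (v \in E); case: (v \in S i).
  rewrite andbF /= (negPf (_ : v \notin S i)) ?orbF //.
  by apply: contraNN cv => /cS ->.
have X_U' v : v \in X -> v \notin E' :|: c @^-1: J'.
  rewrite /X /E' /J' !in_setU in_setD cA cJ in_setD1 negb_or.
  move=> /orP[/cE cv|Sv]; last by rewrite Sv (cS _ _ Sv) eqxx.
  rewrite (negPf cv) andbF andbT negb_and; apply/orP; right.
  by apply: contraNneq cv => ->.
have indepX : {in X &, forall u v, ~~ adj u v}.
  move=> u v; rewrite !(in_setU _ E) => /orP[Eu|Su] /orP[Ev|Sv].
  - exact: indepE.
  - exact: (indepEJ i).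
  - by rewrite adj_sym; exact: (indepEJ i).
  - apply/negP => /(proper_c _ _ (in_setT _) (in_setT _)).
    by rewrite (cS _ _ Su) (cS _ _ Sv) eqxx.
have head_le : head w ts <= t.
  by case: (ts) le_tst => //= a s /andP[].
have cardJ' : #|c @^-1: J| = #|A i| + #|c @^-1: J'|.
  by rewrite (card_preimset_sum c J) (card_preimset_sum c J') (big_setD1 i).
have [||||||| g [proper_g g_J g_ts g_w]] := IHts J' E'.
- by move: size_ts; rewrite (cardsD1 i) Ji => -[].
- by [].
- move=> j /setD1P[_ Jj]; apply: leq_trans head_le _; exact: leJ.
- apply/pred0P => v /=; apply/negP => /andP[/E'P cv].
  by rewrite !inE cv eqxx.
- move=> u v /E'P cu /E'P cv; apply/negP.
  by move=> /(proper_c _ _ (in_setT _) (in_setT _)); rewrite cu cv eqxx.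
(* The only use of the interval structure: u in E' ends no later than some
   x of stream j that precedes v.  Were u adjacent to v, so would be x, which
   has the same color as v. *)
- move=> j u /setD1P[ji Jj] E'u v v_last.
  have Sv : v \in S j.
    apply: (subsetP (last_elts_mono _ _ _)) v_last.
    by rewrite cardE'; lia.
  have lt_u : pos u < endp j.
    by apply: leq_trans (min_i j Jj); exact: (bigop.bigmax_sup u).
  have [x Ax le_ux] : exists2 x, x \in A j :\: S j & pos u <= pos x.
    apply/exists_inP; apply: contraLR lt_u => /exists_inPn nx.
    by rewrite -leqNgt; apply/bigmax_leqP => x /nx; rewrite -ltnNge.
  have lt_xv := last_elts_after Ax Sv.
  have cx : c x = j by move: Ax; rewrite in_setD cA => /andP[_ /eqP].
  have cv := cS _ _ Sv.
  apply/negP => adj_uv; suff : adj x v.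
    by move=> /(proper_c _ _ (in_setT _) (in_setT _)); rewrite cx cv eqxx.
  move: le_ux; rewrite leq_eqVlt => /orP[/eqP/inj_pos <- //|lt_ux].
  exact: chord lt_ux lt_xv adj_uv.
- by rewrite cardE'; lia.
rewrite U_X; set U' := E' :|: _ in X_U' proper_g g_J g_ts g_w *.
have g_i v : v \in U' -> g v != Some i.
  by move=> /g_J; apply: contraTneq => -> /=; rewrite !inE eqxx.
exists (fun v => if v \in X then Some i else g v); split.
- move=> u v; rewrite !(in_setU _ X).
  case: ifP => [Xu _|_ /= U'u]; case: ifP => [Xv _|_ /= U'v].
  + by move=> uv; have := indepX _ _ Xu Xv; rewrite uv.
  + by rewrite eq_sym g_i.
  + by rewrite g_i.
  + exact: proper_g.
- move=> v; rewrite in_setU; case: ifP => //= _ /g_J.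
  by case: (g v) => //= j /setD1P[].
- move=> j Jj; have [->|ji] := eqVneq j i.
    rewrite inE -cardX; apply/orP; left; apply/eqP/eq_card => v.
    rewrite inE in_setU; case: ifP => //= Xv; first by rewrite eqxx.
    by apply/negP => /andP[/g_i/negPf ->].
  rewrite inE; apply/orP; right.
  suff <- : #|[set v in U' | g v == Some j]%SET| =
    #|[set v in X :|: U' | (if v \in X then Some i else g v) == Some j]%SET|.
    by apply: g_ts; rewrite !inE ji.
  apply: eq_card => v; rewrite 2!in_set (in_setU v X); case: ifP => //= Xv.
  by rewrite (negPf (X_U' _ Xv)) /= (inj_eq (@Some_inj _)) eq_sym (negPf ji).
- rewrite -g_w; apply: eq_card => v; rewrite 2!in_set (in_setU v X).
  by case: ifP => //= Xv; rewrite (negPf (X_U' _ Xv)).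
Qed.

(** * From k to k+1 colors *)

Lemma equitably_colorable_card (G : sgraph) (K : finType) (g : G -> K) (q : nat) :
  proper_on [set: G] g ->
  (forall a, q <= #|g @^-1: [set a]| <= q.+1) ->
  equitably_colorable G #|K|.
Proof.
move=> proper_g card_g; apply/existsP; exists [ffun v => enum_rank (g v)].
have class_g i : #|color_class [ffun v => enum_rank (g v)] i| = #|g @^-1: [set enum_val i]|.
  apply: eq_card => v; rewrite !inE ffunE -(inj_eq enum_val_inj).
  by rewrite enum_rankK.
apply/andP; split.
  apply/forallP => u; apply/forallP => v; apply/implyP => uv.
  rewrite !ffunE (inj_eq enum_rank_inj).
  by apply: proper_g uv; rewrite inE.
apply/forallP => i; apply/forallP => j; rewrite !class_g.
have near a b : q <= a <= q.+1 -> q <= b <= q.+1 -> `|a - b|%N <= 1 by lia.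
exact: near (card_g _) (card_g _).
Qed.

(** All classes have at least q vertices, for otherwise none would have more than
    q and n would be less than q k.  If moreover some class has exactly q
    vertices, then every class has q or q+1, and counting vertices
    gives q + r classes of size q+1; if there is none, all k >= r classes are
    available.  In both cases at least r classes can be redistributed. *)
Lemma equitably_colorableS (G : sgraph) (pos : G -> nat) (k : nat) :
  right_end_order pos -> equitably_colorable G k -> equitably_colorable G k.+1.
Proof.
move=> ordG /existsP[c /andP[/forallP proper_c /forallP eq_c]].
pose n := #|G|; pose q := n %/ k.+1; pose r := n %% k.+1.
have def_n : n = q * k.+1 + r := divn_eq n k.+1.
have lt_r : r < k.+1 by rewrite ltn_mod.
pose a i := #|c @^-1: [set i]|.
have class_c i : color_class c i = c @^-1: [set i].
  by apply/setP => v; rewrite !inE.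
have a_eq i j : a i <= (a j).+1.
  have /forallP/(_ j) := eq_c i; rewrite !class_c -/(a i) -/(a j); lia.
have proper : proper_on [set: G] c.
  by move=> u v _ _; have /forallP/(_ v)/implyP := proper_c u.
have cardK (K : {set 'I_k}) : #|c @^-1: K| = \sum_(j in K) a j.
  exact: card_preimset_sum.
have n_sum : n = \sum_j a j.
  transitivity (\sum_(j in [set: 'I_k]) a j); last by apply: eq_bigl => j; rewrite inE.
  by rewrite -cardK preimsetT cardsT.
have le_qa i : q <= a i.
  rewrite leqNgt; apply/negP => lt_aq.
  have : \sum_(j | j != i) a j <= k.-1 * q.
    have -> : k.-1 = #|predC1 i| by rewrite cardC1 card_ord.
    rewrite -sum_nat_const; apply: leq_sum => j _.
    exact: leq_trans (a_eq j i) _.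
  have qk : q * k.+1 = q + (q + k.-1 * q) by have := ltn_ord i; nia.
  by have := n_sum; rewrite (bigD1 i) //= def_n qk; lia.
pose J := [set i | q < a i]%SET.
have a_J i : i \notin J -> a i = q.
  by rewrite inE -leqNgt => le_aq; apply/eqP; rewrite eqn_leq le_aq le_qa.
have cardJC : #|J| + #|~: J| = k by rewrite cardsC card_ord.
have n_J : n = q + r + #|J| * q + #|~: J| * q.
  have := congr1 (muln q) cardJC; rewrite def_n mulnS mulnDr; lia.
have sum_J : #|c @^-1: J| + #|~: J| * q = n.
  rewrite n_sum cardK (bigID (mem J) predT) /=; congr (_ + _).
  rewrite -sum_nat_const; apply: eq_big => i; rewrite ?inE //.
  by move=> Ji; rewrite a_J // inE.
have le_rJ : r <= #|J|.
  have [JC0|/set0Pn[i]] := eqVneq (~: J) set0.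
    by move: cardJC; rewrite JC0 cards0; lia.
  rewrite inE => Ji; have : #|c @^-1: J| = #|J| * q.+1.
    rewrite cardK -sum_nat_const; apply: eq_bigr => j; rewrite inE => lt_qa.
    by apply/eqP; rewrite eqn_leq lt_qa andbT -(a_J i Ji).
  by move: sum_J; rewrite n_J; lia.
pose ts := nseq r q.+1 ++ nseq (#|J| - r) q.
have [|||||||g [proper_g g_J g_ts g_w]] :=
  @redistribute G pos _ c ts q J set0 ordG proper.
- by rewrite size_cat !size_nseq; lia.
- exact: sorted_two_levels.
- move=> j; rewrite inE => lt_qa; apply: leq_trans lt_qa.
  by rewrite /ts; case: (r) => //=; case: (_ - _) => /=.
- by rewrite disjoints_subset sub0set.
- by move=> u v; rewrite inE.
- by move=> j u _; rewrite inE.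
- rewrite cards0 add0n /ts sumn_cat !sumn_nseq mulnBr.
  have := leq_mul2l q r #|J|; rewrite le_rJ orbT.
  by move: sum_J; rewrite n_J; lia.
rewrite !set0U in proper_g g_J g_ts g_w.
clearbody J.
have -> : k.+1 = #|{: option 'I_k}| by rewrite card_option card_ord.
pose h v := if c v \in J then g v else Some (c v).
apply: (@equitably_colorable_card _ _ h q).
  move=> u v _ _ uv; rewrite /h.
  case: ifP => Ju; case: ifP => Jv.
  + by apply: proper_g uv; rewrite inE.
  + by have := g_J u; rewrite inE Ju => /(_ isT); apply: contraTneq => -> /=; rewrite Jv.
  + by have := g_J v; rewrite inE Jv => /(_ isT); apply: contraTneq => <- /=; rewrite Ju.
  + by apply: contraNneq (proper u v (in_setT _) (in_setT _) uv) => -[->].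
have mem_ts t : t \in ts -> q <= t <= q.+1.
  by rewrite mem_cat !mem_nseq => /orP[] /andP[_ /eqP ->]; rewrite leqnn leqnSn.
case=> [i|]; last first.
  suff -> : #|h @^-1: [set None]| = q by rewrite leqnn leqnSn.
  by rewrite -g_w; apply: eq_card => v; rewrite !inE /h; case: (c v \in J).
have [Ji|Ji] := boolP (i \in J).
  apply: mem_ts.
  suff -> : #|h @^-1: [set Some i]| =
    #|[set v in c @^-1: J | g v == Some i]%SET| by exact: g_ts.
  apply: eq_card => v; rewrite !inE /h; case: ifP => //= Jv.
  by apply/negP => /eqP[cv]; rewrite cv Ji in Jv.
suff -> : #|h @^-1: [set Some i]| = q by rewrite leqnn leqnSn.
rewrite -(a_J i Ji); apply: eq_card => v; rewrite !inE /h; case: ifP => //= Jv.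
have := g_J v; rewrite inE Jv => /(_ isT); case: (g v) => [j|] /=.
  move=> Jj; rewrite [LHS](_ : _ = false) 1?[RHS](_ : _ = false) //.
    by apply/negP => /eqP cv; rewrite cv in Jv; rewrite Jv in Ji.
  by apply/negP => /eqP[ji]; rewrite ji in Jj; rewrite Jj in Ji.
by move=> _; apply/esym/negP => /eqP cv; rewrite cv in Jv; rewrite Jv in Ji.
Qed.

Theorem theorem3 (R : realType) (G : sgraph) (hG : interval_graph R G) :
  equitable_chromatic_number G = equitable_chromatic_threshold G.
Proof.
have [pos ordG] := interval_right_end_order hG.
rewrite /equitable_chromatic_number /equitable_chromatic_threshold.
case: ex_minnP => m col_m min_m; case: ex_minnP => t /asboolP col_t min_t.
apply/eqP; rewrite eqn_leq min_m ?col_t //= min_t //; apply/asboolP => k.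
elim: k => [|k IHk]; first by rewrite leqn0 => /eqP <-.
rewrite leq_eqVlt => /orP[/eqP <- //|/IHk].
exact: equitably_colorableS ordG.
Qed.
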